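(* Let $\mathcal{M}_1=(V,\mathcal{I}_1)$ and $\mathcal{M}_2=(V,\mathcal{I}_2)$ be two matroids on the same finite ground set $V$, both of rank $k$ and without loops. Let $\varepsilon>0$ and let $\beta,\beta^-$ be integers such that $\beta\ge\beta^-+7$ and $(\beta^--4)\cdot(1+\varepsilon)\ge\beta$. Then every $(\beta,\beta^-)$-DCS $V'\subseteq V$ of $\mathcal{M}_1,\mathcal{M}_2$ satisfies $\mu(V)\le(3/2+\varepsilon)\cdot\mu(V')$, i.e. $V'$ contains a common independent set of size at least $\mu(V)/(3/2+\varepsilon)$.
   Context: A loop is an element $v$ with $\{v\}$ not independent. For $X\subseteq V$, $\mu(X)$ denotes the maximum cardinality of a set $S\subseteq X$ with $S\in\mathcal{I}_1\cap\mathcal{I}_2$. For a matroid $\mathcal{M}=(V,\mathcal{I})$ and $U\subseteq V$, the density is $\rho_{\mathcal{M}}(U)=|U|/\mathrm{rank}_{\mathcal{M}}(U)$, with $\rho_{\mathcal{M}}(\emptyset)=0$ and $\rho_{\mathcal{M}}(U)=+\infty$ if $U\neq\emptyset$ has rank $0$. $\mathcal{M}|V'$ is the restriction to $V'$; for $U\subseteq V$, the contraction $\mathcal{M}/U$ has ground set $V\setminus U$ and independent sets $\{S\subseteq V\setminus U: S\cup B_U\in\mathcal{I}\}$ for any maximal independent $B_U\subseteq U$. Density-based decomposition of $V'\subseteq V$ in a matroid $\mathcal{M}$ of rank $k$: let $\mathcal{M}'=\mathcal{M}|V'$; for $j=1,\dots,k$, $U_j$ is the (unique) subset of largest cardinality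 among the subsets of $V'\setminus(U_1\cup\dots\cup U_{j-1})$ of maximum density in $\mathcal{M}'/(U_1\cup\dots\cup U_{j-1})$ (some $U_j$ may be empty). The associated density of $v\in V$ with respect to $V'$ is $\tilde\rho_{\mathcal{M}}(v)=\rho_{\mathcal{M}'/(U_1\cup\dots\cup U_{j-1})}(U_j)$ where $j$ is the least index with $v\in\mathrm{span}_{\mathcal{M}}(U_1\cup\dots\cup U_j)$, if $v\in\mathrm{span}_{\mathcal{M}}(V')$, and $\tilde\rho_{\mathcal{M}}(v)=0$ otherwise. For integers $\beta\ge\beta^-+7$, a set $V'\subseteq V$ is a $(\beta,\beta^-)$-DCS (density-constrained subset) of $\mathcal{M}_1,\mathcal{M}_2$ if, with associated densities taken with respect to $V'$: (i) $\tilde\rho_{\mathcal{M}_1}(v)+\tilde\rho_{\mathcal{M}_2}(v)\le\beta$ for all $v\in V'$; (ii) $\tilde\rho_{\mathcal{M}_1}(v)+\tilde\rho_{\mathcal{M}_2}(v)\ge\beta^-$ for all $v\in V\setminus V'$. *)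

(* Defs.v *)
From mathcomp Require Import all_boot all_order all_algebra.
From mathcomp Require Import reals constructive_ereal.
Set Implicit Arguments.
Unset Strict Implicit.
Unset Printing Implicit Defensive.
Import Order.TTheory GRing.Theory Num.Theory.

(* Written in MathComp, with the real numbers and extended real numbers of
   MathComp-Analysis. *)

(* The ground set is a field of the record, rather than the whole of T, so that
   restrictions and contractions are again matroids over the same finType. *)
Record matroid (T : finType) := Matroid {
  ground : {set T};
  indep : {set {set T}};
  indep_ground : forall S, S \in indep -> S \subset ground;
  indep0 : set0 \in indep;
  indepS : forall A B : {set T}, A \subset B -> B \in indep -> A \in indep;
  indep_aug : forall A B : {set T}, A \in indep -> B \in indep ->
    #|A| < #|B| -> exists2 x, x \in B :\: A & x |: A \in indep }.

Section Matroid.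
Variable T : finType.
Implicit Types (M : matroid T) (A B S U X : {set T}).

Definition rank M U : nat := \max_(S in indep M | S \subset U) #|S|.

Definition loopless M : bool := [forall v in ground M, [set v] \in indep M].

Definition span M U : {set T} :=
  [set v in ground M | rank M (v |: U) == rank M U].

Definition maximal_indep M U B : bool :=
  maxset [pred S : {set T} | (S \in indep M) && (S \subset U)] B.

Lemma maximal_indep_exists M U : exists B, maximal_indep M U B.
Proof.
have [|B maxB _] := @maxset_exists _
    [pred S : {set T} | (S \in indep M) && (S \subset U)] set0.
  by rewrite inE indep0 sub0set.
by exists B.
Qed.

Lemma indep_extend M A B : A \in indep M -> B \in indep M -> #|A| <= #|B| ->
  exists X, [/\ X \in indep M, A \subset X, X \subset A :|: B & #|X| = #|B|].
Proof.
move=> iA iB; move: {2}(#|B| - #|A|) (erefl (#|B| - #|A|)) => n.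
elim: n A iA => [|n IHn] A iA eqn leAB.
  exists A; split=> //; first exact: subsetUl.
  by apply/eqP; rewrite eqn_leq leAB -subn_eq0 eqn.
have ltAB : #|A| < #|B| by rewrite -subn_gt0 eqn.
have [x /setDP[xB xA] ixA] := indep_aug iA iB ltAB.
have cxA : #|x |: A| = #|A|.+1 by rewrite cardsU1 xA.
have [||X [iX sX sXU cX]] := IHn _ ixA; rewrite ?cxA //.
  by rewrite subnS eqn.
exists X; split=> //; first exact: subset_trans (subsetUr _ _) sX.
apply: subset_trans sXU _; rewrite -setUA subUset subxx andbT sub1set.
by rewrite inE xB orbT.
Qed.

Lemma maximal_indep_leq_card M U A B :
  maximal_indep M U B -> A \in indep M -> A \subset U -> #|A| <= #|B|.
Proof.
move=> /maxsetP[/andP[iB sB] maxB] iA sA; rewrite leqNgt; apply/negP => ltBA.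
have [x /setDP[xA /negP xB] ixB] := indep_aug iB iA ltBA.
apply: xB; rewrite -(maxB (x |: B)) ?setU11 ?subsetUr //= ixB /=.
by rewrite subUset sub1set (subsetP sA).
Qed.

Lemma maximal_indep_swap M U B B' S :
    maximal_indep M U B -> maximal_indep M U B' ->
    S \subset ground M :\: U -> S :|: B \in indep M -> S :|: B' \in indep M.
Proof.
move=> mB mB' sS iSB.
have /maxsetP[/andP[iB sB] _] := mB; have /maxsetP[/andP[iB' sB'] max'] := mB'.
have cB : #|B'| = #|B|.
  by apply/eqP; rewrite eqn_leq !(@maximal_indep_leq_card M U).
have dSU : [disjoint S & U].
  by rewrite disjoints_subset (subset_trans sS) // subsetDr.
have cSB : #|S :|: B| = #|S| + #|B|.
  by apply/eqP; rewrite (leq_card_setU _ _).2; apply: disjointWr dSU.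
have [|X [iX sB'X sX cX]] := indep_extend iB' iSB.
  by rewrite cSB cB leq_addl.
have XU : X :&: U = B'.
  apply: max'; last by rewrite subsetI sB'X.
  by rewrite /= subsetIr (indepS _ iX) ?subsetIl.
have sXS : X :\: U \subset S.
  apply/subsetP=> x /setDP[/(subsetP sX)]; rewrite !inE.
  case/or3P=> // [/(subsetP sB')|/(subsetP sB)] ->; by [].
have eXS : X :\: U = S.
  apply/eqP; rewrite eqEcard sXS /=.
  by have := cardsID U X; rewrite XU cX cSB cB addnC => /addIn ->.
by rewrite -eXS -XU setUC setID.
Qed.

Section Restrict.
Variables (M : matroid T) (X : {set T}).

Let rindep : {set {set T}} := [set S in indep M | S \subset X].

Lemma restrict_ground S : S \in rindep -> S \subset ground M :&: X.
Proof. by rewrite inE subsetI => /andP[/indep_ground-> ->]. Qed.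

Lemma restrict0 : set0 \in rindep.
Proof. by rewrite inE indep0 sub0set. Qed.

Lemma restrictS A B : A \subset B -> B \in rindep -> A \in rindep.
Proof.
by rewrite !inE => sAB /andP[iB sB]; rewrite (indepS sAB) ?(subset_trans sAB).
Qed.

Lemma restrict_aug A B : A \in rindep -> B \in rindep -> #|A| < #|B| ->
  exists2 x, x \in B :\: A & x |: A \in rindep.
Proof.
rewrite !inE => /andP[iA sA] /andP[iB sB] ltAB.
have [x xBA ixA] := indep_aug iA iB ltAB; exists x => //.
rewrite inE ixA subUset sub1set sA andbT (subsetP sB) //.
by case/setDP: xBA.
Qed.

Definition restrict : matroid T :=
  Matroid restrict_ground restrict0 restrictS restrict_aug.

End Restrict.

Section Contract.
Variables (M : matroid T) (U : {set T}).

(* The choice of B is irrelevant, see contract_indepE. *)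
Let cindep : {set {set T}} :=
  [set S : {set T} | (S \subset ground M :\: U) &&
     [exists B, maximal_indep M U B && (S :|: B \in indep M)]].

Let cindepE B S : maximal_indep M U B ->
  (S \in cindep) = (S \subset ground M :\: U) && (S :|: B \in indep M).
Proof.
move=> mB; rewrite inE; case: (boolP (S \subset _)) => //= sS.
apply/existsP/idP => [[B' /andP[mB' iSB']]|iSB].
  exact: maximal_indep_swap mB' mB sS iSB'.
by exists B; rewrite mB.
Qed.

Lemma contract_ground S : S \in cindep -> S \subset ground M :\: U.
Proof. by rewrite inE => /andP[]. Qed.

Lemma contract0 : set0 \in cindep.
Proof.
have [B mB] := maximal_indep_exists M U.
rewrite (cindepE _ mB) sub0set set0U.
by have /maxsetP[/andP[]] := mB.
Qed.

Lemma contractS A B : A \subset B -> B \in cindep -> A \in cindep.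
Proof.
have [C mC] := maximal_indep_exists M U.
rewrite !(cindepE _ mC) => sAB /andP[sB iB].
by rewrite (subset_trans sAB) //= (indepS _ iB) ?setSU.
Qed.

Lemma contract_aug A B : A \in cindep -> B \in cindep -> #|A| < #|B| ->
  exists2 x, x \in B :\: A & x |: A \in cindep.
Proof.
have [C mC] := maximal_indep_exists M U.
have /maxsetP[/andP[_ sC] _] := mC.
rewrite !(cindepE _ mC) => /andP[sA iA] /andP[sB iB] ltAB.
have cU S : S \subset ground M :\: U -> #|S :|: C| = #|S| + #|C|.
  move=> sS; apply/eqP; rewrite (leq_card_setU _ _).2.
  apply: disjointWr sC _.
  by rewrite disjoints_subset (subset_trans sS) // subsetDr.
have [|x] := indep_aug iA iB; first by rewrite !cU // ltn_add2r.
rewrite !inE negb_or => /andP[/andP[xA xC]]; rewrite (negPf xC) orbF => xB ixA.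
exists x; first by rewrite !inE xA.
by rewrite (cindepE _ mC) -setUA ixA subUset sub1set sA (subsetP sB).
Qed.

Definition contract : matroid T :=
  Matroid contract_ground contract0 contractS contract_aug.

Lemma contract_indepE B S : maximal_indep M U B ->
  (S \in indep contract) =
  (S \subset ground M :\: U) && (S :|: B \in indep M).
Proof. exact: cindepE. Qed.

End Contract.

Definition common_indep_max (M1 M2 : matroid T) (X : {set T}) : nat :=
  \max_(S : {set T} | [&& S \subset X, S \in indep M1 & S \in indep M2]) #|S|.

End Matroid.

Section Density.
Variables (R : realType) (T : finType).
Implicit Types (M : matroid T) (U W : {set T}) (v : T).
Local Open Scope ring_scope.
Local Open Scope ereal_scope.

Definition density M U : \bar R :=
  if U == set0 then 0
  else if rank M U == 0%N then +oo
  else (#|U|%:R / (rank M U)%:R)%:E.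

Definition is_densest M U : bool :=
  [&& U \subset ground M,
      [forall W : {set T}, (W \subset ground M) ==> (density M W <= density M U)]
    & [forall W : {set T}, (W \subset ground M) && (density M W == density M U)
        ==> (#|W| <= #|U|)%N]].

(* The default value is never used, see densest_subsetP, and the subset picked
   is unique since the union of two densest subsets is a subset of maximum
   density. *)
Definition densest_subset M : {set T} := odflt set0 [pick U | is_densest M U].

Lemma densest_subsetP M : is_densest M (densest_subset M).
Proof.
rewrite /densest_subset; case: pickP => //= noU; exfalso.
pose P := [pred U : {set T} | U \subset ground M].
have P0 : P set0 by rewrite /= sub0set.
case: (@arg_maxP _ _ _ set0 P (density M) P0) => U0 PU0 maxU0.
pose Q := [pred U | P U && (density M U == density M U0)].
have QU0 : Q U0 by apply/andP; split.
case: (@arg_maxnP _ U0 Q (fun U => #|U|) QU0) => U /andP[PU /eqP dU] maxU.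
have /negP[] := negbT (noU U); apply/and3P; split=> //.
  by apply/forallP=> W; apply/implyP=> PW; rewrite dU; apply: maxU0.
by apply/forallP=> W; apply/implyP; rewrite dU => QW; apply: maxU.
Qed.

(* U_1 :|: ... :|: U_j *)
Fixpoint decomp_union M (V' : {set T}) (j : nat) : {set T} :=
  if j is i.+1 then
    decomp_union M V' i :|:
      densest_subset (contract (restrict M V') (decomp_union M V' i))
  else set0.

(* Indices start at 1, so decomp_part M V' j is U_j for j > 0. *)
Definition decomp_part M (V' : {set T}) (j : nat) : {set T} :=
  densest_subset (contract (restrict M V') (decomp_union M V' j.-1)).

(* The least j in 1, ..., rank of M such that v is spanned by the union of
   U_1, ..., U_j. In a loopless matroid, such a j exists for every v in
   span M V', since every nonempty U_j increases the rank of the union. *)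
Definition decomp_index M (V' : {set T}) v : nat :=
  (find (fun j => v \in span M (decomp_union M V' j))
        (iota 1 (rank M (ground M)))).+1.

Definition assoc_density M (V' : {set T}) v : \bar R :=
  if v \in span M V' then
    let j := decomp_index M V' v in
    density (contract (restrict M V') (decomp_union M V' j.-1))
            (decomp_part M V' j)
  else 0.

(* M1 and M2 are meant to have the same ground set. *)
Definition is_DCS (M1 M2 : matroid T) (beta beta_minus : int)
    (V' : {set T}) : Prop :=
  [/\ V' \subset ground M1,
      forall v, v \in V' ->
        assoc_density M1 V' v + assoc_density M2 V' v <= (beta%:~R)%:E
    & forall v, v \in ground M1 :\: V' ->
        (beta_minus%:~R)%:E <= assoc_density M1 V' v + assoc_density M2 V' v].

End Density.

(* Main.v *)
(* By matroid intersection there is [A \subset V'] with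
   [r1 A + r2 (V' :\: A) <= mu V'].  From a maximum common independent set extract
   [O], independent in both M1/A and M2/(V' :\: A), of size at least
   [mu V - mu V']; it avoids V', so the associated densities satisfy
   [rho1 + rho2 >= beta^-] on [O].  It remains to
   see that [O] is at most about half as large as [mu V'].
   - Any [B \subset V'] has [sum_(e in B) 1 / rho e <= r B].
   - If [O] is independent in M/A, and [g] is nondecreasing and nonnegative with
     [g 0 = 0], then [sum_O (g \o rho) <= sum_(e in V' :\: A) g (rho e) / rho e].
   Take [g x = max 0 (beta * x - s ^+ 2)] in the second fact.  For e in V',
   [rho1 e + rho2 e <= beta] gives [g (rho1 e) / rho1 e <= t ^+ 2 / rho2 e]
   whenever [s + t = beta], and the first fact bounds what is left by the other
   rank.  Adding both matroids, with [s = beta^- / 2] (half the least degree of an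
   element of [O]) and [t = beta - s],
   [#|O| * (beta * beta^- - 2 * s ^+ 2) <= t ^+ 2 * mu V']. *)
Require Import Defs.
From mathcomp Require Import all_boot all_order all_algebra.
From mathcomp Require Import reals constructive_ereal.
From mathcomp Require Import zify ring lra.
Import Order.TTheory GRing.Theory Num.Theory.
Local Open Scope ring_scope.
Set Implicit Arguments.
Unset Strict Implicit.

(* Needed because mathcomp's vector and constructive_ereal, imported after Defs,
   export a [span] and a [contract] of their own. *)
Local Notation span := Defs.span.
Local Notation contract := Defs.contract.

(** * Rank function: submodularity, span, restriction and contraction *)

Section Rank.
Local Open Scope nat_scope.
Variable T : finType.
Implicit Types (M : matroid T) (A B O P S U V W X Y Z : {set T}).

Lemma card_indep_le_rank M S U : S \in indep M -> S \subset U -> #|S| <= rank M U.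
Proof. by move=> iS sS; apply: leq_bigmax_cond; rewrite iS. Qed.

Lemma rank_leP M U n :
  reflect (forall S, S \in indep M -> S \subset U -> #|S| <= n) (rank M U <= n).
Proof.
apply: (iffP (bigmax_leqP _ _ _)) => H S.
  by move=> iS sS; apply: H; rewrite iS.
by case/andP; apply: H.
Qed.

Lemma rankS M U W : U \subset W -> rank M U <= rank M W.
Proof.
move=> sUW; apply/rank_leP=> S iS sS.
by apply: card_indep_le_rank => //; apply: subset_trans sUW.
Qed.

Lemma rank_le_card M U : rank M U <= #|U|.
Proof. by apply/rank_leP=> S _; apply: subset_leq_card. Qed.

Lemma rank0 M : rank M set0 = 0.
Proof. by apply/eqP; rewrite -leqn0 -(cards0 T) rank_le_card. Qed.

Lemma rank_indep M S : S \in indep M -> rank M S = #|S|.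
Proof.
by move=> iS; apply/eqP; rewrite eqn_leq rank_le_card card_indep_le_rank.
Qed.

Lemma rank_maximal_indep M U B : maximal_indep M U B -> rank M U = #|B|.
Proof.
move=> mB; apply/eqP; rewrite eqn_leq; apply/andP; split.
  by apply/rank_leP=> S; apply: maximal_indep_leq_card mB.
by have /maxsetP[/andP[iB sB] _] := mB; apply: card_indep_le_rank.
Qed.

Lemma indep_extend_maximal M A U : A \in indep M -> A \subset U ->
  exists2 B, maximal_indep M U B & A \subset B.
Proof.
move=> iA sA.
have [|B mB sAB] := @maxset_exists _
    [pred S : {set T} | (S \in indep M) && (S \subset U)] A.
  by rewrite inE iA.
by exists B.
Qed.

(** Extend a basis [C] of the intersection to a basis [D] of the union: the traces of [D] on [A] and
    [B] are independent and both contain [C]. *)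
Lemma rank_submod M A B :
  rank M (A :|: B) + rank M (A :&: B) <= rank M A + rank M B.
Proof.
have [C mC] := maximal_indep_exists M (A :&: B).
have /maxsetP[/andP[iC sC] _] := mC.
have [|D mD sCD] := @indep_extend_maximal M C (A :|: B) iC.
  by apply: subset_trans sC _; rewrite subIset // subsetUl.
have /maxsetP[/andP[iD sD] _] := mD.
rewrite (rank_maximal_indep mC) (rank_maximal_indep mD).
have iDI X : D :&: X \in indep M by apply: indepS iD; apply: subsetIl.
apply: leq_trans (leq_add (card_indep_le_rank (iDI A) (subsetIr _ _))
                          (card_indep_le_rank (iDI B) (subsetIr _ _))).
rewrite -[leqRHS]cardsUI -setIUr (setIidPl sD) leq_add2l subset_leq_card //.
by rewrite -setIIr subsetI sCD.
Qed.

(** If the rank grew, augmenting a basis of [U] would yield a single [x] that already raises the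
    rank. *)
Lemma rank_closure M U X :
  (forall x, x \in X -> rank M (x |: U) = rank M U) -> rank M (X :|: U) = rank M U.
Proof.
move=> HX; apply/eqP; rewrite eqn_leq [X in _ && X]rankS ?subsetUr // andbT leqNgt.
apply/negP => lt.
have [B mB] := maximal_indep_exists M U.
have /maxsetP[/andP[iB sB] _] := mB.
have [C mC] := maximal_indep_exists M (X :|: U).
have /maxsetP[/andP[iC sC] _] := mC.
rewrite (rank_maximal_indep mB) (rank_maximal_indep mC) in lt.
have [x /setDP[xC xB] ixB] := indep_aug iB iC lt.
have: rank M (x |: U) = rank M U.
  have /setUP[/HX //|xU] := subsetP sC _ xC.
  by rewrite (setUidPr _) ?sub1set.
have := card_indep_le_rank ixB (setUS [set x] sB).
by rewrite (rank_maximal_indep mB) cardsU1 xB; lia.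
Qed.

Lemma spanP M U v :
  reflect (v \in ground M /\ rank M (v |: U) = rank M U) (v \in span M U).
Proof.
by rewrite inE; apply: (iffP andP) => -[-> /eqP].
Qed.

Lemma rankU_span M U X : X \subset span M U -> rank M (X :|: U) = rank M U.
Proof. by move=> /subsetP sX; apply: rank_closure => x /sX /spanP[]. Qed.

Lemma rankU1_mono M A B x : A \subset B ->
  rank M (x |: A) = rank M A -> rank M (x |: B) = rank M B.
Proof.
move=> sAB eA; apply/eqP; rewrite eqn_leq [X in _ && X]rankS ?subsetUr // andbT.
have := rank_submod M (x |: A) B; rewrite -setUA (setUidPr sAB).
have : rank M A <= rank M ((x |: A) :&: B) by rewrite rankS // subsetI subsetUr.
by lia.
Qed.

Lemma spanS M A B : A \subset B -> span M A \subset span M B.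
Proof.
move=> sAB; apply/subsetP=> x /spanP[gx eA]; apply/spanP; split=> //.
exact: rankU1_mono sAB eA.
Qed.

Lemma rank_restrict M V X : X \subset V -> rank (restrict M V) X = rank M X.
Proof.
move=> sXV; apply/eqP; rewrite eqn_leq; apply/andP.
split; apply/rank_leP=> S.
  by rewrite inE => /andP[iS _]; apply: card_indep_le_rank.
move=> iS sS; apply: card_indep_le_rank => //.
by rewrite inE iS (subset_trans sS).
Qed.

Lemma rank_contract M W X : [disjoint X & W] ->
  rank (contract M W) X + rank M W = rank M (X :|: W).
Proof.
move=> dXW; have [B mB] := maximal_indep_exists M W.
have /maxsetP[/andP[iB sB] _] := mB.
have card_XB S : S \subset X -> #|S :|: B| = #|S| + #|B|.
  move=> sS; apply/eqP; rewrite (leq_card_setU _ _).2.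
  exact: disjointWl sS (disjointWr sB dXW).
rewrite (rank_maximal_indep mB); apply/eqP; rewrite eqn_leq; apply/andP; split.
  have [C mC] := maximal_indep_exists (contract M W) X.
  have /maxsetP[/andP[+ sC] _] := mC.
  rewrite (rank_maximal_indep mC) (contract_indepE _ mB) => /andP[_ iCB].
  by rewrite -card_XB //; apply: card_indep_le_rank => //; apply: setUSS.
have [|C mC sBC] := @indep_extend_maximal M B (X :|: W) iB.
  exact: subset_trans sB (subsetUr _ _).
have /maxsetP[/andP[iC sC] _] := mC.
rewrite (rank_maximal_indep mC).
(* [B] is a basis of [W], so [C] gains nothing more there, and [C :\: W] is independent in the
   contraction. *)
have CW : C :&: W = B.
  have /maxsetP[_ max] := mB.
  apply: max; last by rewrite subsetI sBC.
  by rewrite /= subsetIr (indepS _ iC) ?subsetIl.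
rewrite -(cardsID W C) CW addnC leq_add2r; apply: card_indep_le_rank.
  rewrite (contract_indepE _ mB) setSD ?(indep_ground iC) //=.
  by apply: indepS iC; rewrite subUset subsetDl.
by rewrite subDset setUC.
Qed.

Lemma rank_contract_restrict M V W X : W \subset V -> X \subset V :\: W ->
  rank (contract (restrict M V) W) X + rank M W = rank M (X :|: W).
Proof.
move=> sW /subsetDP[sX dXW].
rewrite -(rank_restrict M sW) rank_contract // rank_restrict //.
by rewrite subUset sX.
Qed.

(** * Common independent sets and the matroid intersection theorem *)

Lemma common_indep_max_ge M1 M2 X S :
  S \subset X -> S \in indep M1 -> S \in indep M2 ->
  #|S| <= common_indep_max M1 M2 X.
Proof.
by move=> sS i1 i2; apply: leq_bigmax_cond; rewrite sS i1.
Qed.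

Lemma common_indep_max_witness M1 M2 X : exists S,
  [/\ S \subset X, S \in indep M1, S \in indep M2
    & #|S| = common_indep_max M1 M2 X].
Proof.
have [|S /and3P[]] := @eq_bigmax_cond _
  [pred S : {set T} | [&& S \subset X, S \in indep M1 & S \in indep M2]]
  (fun S => #|S|).
  by apply/card_gt0P; exists set0; rewrite inE sub0set !indep0.
by exists S.
Qed.

Lemma common_indep_maxS M1 M2 X Y : X \subset Y ->
  common_indep_max M1 M2 X <= common_indep_max M1 M2 Y.
Proof.
move=> sXY; have [S [sS i1 i2 <-]] := common_indep_max_witness M1 M2 X.
by apply: common_indep_max_ge => //; apply: subset_trans sXY.
Qed.

Lemma rank1_indep M v : 0 < rank M [set v] -> [set v] \in indep M.
Proof.
move=> r_gt0; have [B mB] := maximal_indep_exists M [set v].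
have /maxsetP[/andP[iB]] := mB.
rewrite subset1 => /orP[/eqP <- //|/eqP B0].
by move: r_gt0; rewrite (rank_maximal_indep mB) B0 cards0.
Qed.

(** Adding [e] to a common independent set of the contractions gives one of the original
    matroids. *)
Lemma common_indep_max_contract1 M1 M2 e Y : e \notin Y ->
    [set e] \in indep M1 -> [set e] \in indep M2 ->
  common_indep_max (contract M1 [set e]) (contract M2 [set e]) Y
    < common_indep_max M1 M2 (e |: Y).
Proof.
move=> eY i1 i2.
have mB M : [set e] \in indep M -> maximal_indep M [set e] [set e].
  move=> ie; apply/maxsetP; split; first by rewrite /= ie subxx.
  by move=> B /andP[_ sB] sB'; apply/eqP; rewrite eqEsubset sB.
have [S [sS]] := common_indep_max_witness (contract M1 [set e]) (contract M2 [set e]) Y.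
rewrite (contract_indepE _ (mB _ i1)) (contract_indepE _ (mB _ i2)).
move=> /andP[_ iS1] /andP[_ iS2] <-.
have -> : #|S|.+1 = #|S :|: [set e]|.
  by rewrite setUC cardsU1 (contraNN (subsetP sS e)).
by apply: common_indep_max_ge; rewrite // setUC setUS.
Qed.

(* The hard direction of Edmonds' theorem.  If neither deleting nor contracting
   [e] gave a good partition of [X], uncrossing the two partitions by
   submodularity would. *)
Lemma matroid_intersection M1 M2 X : exists2 A : {set T}, A \subset X &
  rank M1 A + rank M2 (X :\: A) <= common_indep_max M1 M2 X.
Proof.
have [n] := ubnP #|X|; elim: n => // n IHn in M1 M2 X *; rewrite ltnS => leXn.
have [/existsP[e /and3P[eX r1 r2]]|noe] :=
  boolP [exists e, [&& e \in X, 0 < rank M1 [set e] & 0 < rank M2 [set e]]];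
  last first.
  (* Every element is a loop of [M1] or of [M2]: once [A] takes all loops of [M1], both ranks
     vanish. *)
  exists [set x in X | rank M1 [set x] == 0].
    by apply/subsetP=> x; rewrite inE => /andP[].
  have rank_loops M Z : (forall x, x \in Z -> rank M [set x] = 0) -> rank M Z = 0.
    move=> loopZ; rewrite -[Z]setU0 -[RHS](rank0 M); apply: rank_closure => x xZ.
    by rewrite setU0 loopZ ?rank0.
  rewrite !rank_loops // => x.
    rewrite !inE => /andP[+ xX]; rewrite xX /= -lt0n => r1.
    move: noe; rewrite negb_exists => /forallP /(_ x).
    by rewrite xX r1 /= -eqn0Ngt => /eqP.
  by rewrite inE => /andP[_ /eqP].
have eY : e \notin X :\ e by rewrite setD11.
have ltY : #|X :\ e| < n by move: leXn; rewrite (cardsD1 e) eX.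
have XE : e |: (X :\ e) = X by rewrite setD1K.
have [A1 sA1 le1] := IHn M1 M2 _ ltY.
have [A2 sA2 le2] := IHn (contract M1 [set e]) (contract M2 [set e]) _ ltY.
have lt2 := common_indep_max_contract1 eY (rank1_indep r1) (rank1_indep r2).
rewrite XE in lt2.
have leS := common_indep_maxS M1 M2 (subD1set X e).
have rank_c M Z : 0 < rank M [set e] -> Z \subset X :\ e ->
    (rank (contract M [set e]) Z).+1 = rank M (e |: Z).
  move=> r_gt0 sZ; rewrite setUC -rank_contract.
    by rewrite (rank_indep (rank1_indep r_gt0)) cards1 addn1.
  by rewrite disjoint_sym disjoints1 (contraNN (subsetP sZ e)).
have /= c1 := rank_c _ _ r1 sA2; have /= c2 := rank_c _ _ r2 (subsetDl _ A2).
have := rank_submod M1 A1 (e |: A2).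
have := rank_submod M2 ((X :\ e) :\: A1) (e |: ((X :\ e) :\: A2)).
set P1 := A1 :|: (e |: A2); set P2 := A1 :&: (e |: A2).
have sA1X := subset_trans sA1 (subD1set X e).
have sA2X := subset_trans sA2 (subD1set X e).
have sP1 : P1 \subset X by rewrite !subUset sA1X sA2X sub1set eX.
have sP2 : P2 \subset X by rewrite subIset ?sA1X.
have eA1 : e \notin A1 by rewrite (contraNN (subsetP sA1 e)).
have -> : ((X :\ e) :\: A1) :&: (e |: ((X :\ e) :\: A2)) = X :\: P1.
  by apply/setP=> x; rewrite /P1 !inE; case: (eqVneq x e) => [->|_] /=;
     rewrite ?andbF ?orbT //; case: (x \in A1); case: (x \in A2); case: (x \in X).
have -> : ((X :\ e) :\: A1) :|: (e |: ((X :\ e) :\: A2)) = X :\: P2.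
  by apply/setP=> x; rewrite /P2 !inE; case: (eqVneq x e) => [->|_] /=;
     rewrite ?eX ?(negPf eA1) //;
     case: (x \in A1); case: (x \in A2); case: (x \in X).
move=> sub2 sub1.
(* The four ranks add up to at most [2 * common_indep_max M1 M2 X + 1]: [e] costs one in each
   matroid, and [lt2] recovers one. So [P1] or [P2] is good. *)
have [le|gt] := leqP (rank M1 P1 + rank M2 (X :\: P1)) (common_indep_max M1 M2 X).
  by exists P1.
by exists P2 => //; lia.
Qed.

(** * Sets free over [A]: [rank M (O :|: A) = #|O| + rank M A] says that [O] is independent in
    M/A *)

Lemma exists_free_over M A S : S \in indep M -> exists O : {set T},
  [/\ O \subset S, rank M (O :|: A) = #|O| + rank M A & #|S| <= #|O| + rank M A].
Proof.
move=> iS; have [C mC] := maximal_indep_exists M A.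
have /maxsetP[/andP[iC sC] maxC] := mC.
have [|D mD sCD] := @indep_extend_maximal M C (S :|: A) iC.
  exact: subset_trans sC (subsetUr _ _).
have /maxsetP[/andP[iD sD] _] := mD.
have DA : D :&: A = C.
  apply: maxC; last by rewrite subsetI sCD.
  by rewrite /= subsetIr (indepS _ iD) ?subsetIl.
have cD := cardsID A D; rewrite DA in cD.
exists (D :\: A); rewrite (rank_maximal_indep mC) addnC cD; split.
- by rewrite subDset setUC.
- rewrite -(rank_maximal_indep mD); apply/eqP; rewrite eqn_leq; apply/andP; split.
    by apply: rankS; rewrite setSU // subDset setUC.
  rewrite (rank_maximal_indep mD); apply: card_indep_le_rank => //.
  by rewrite setUC -subDset.
- by rewrite -(rank_maximal_indep mD) card_indep_le_rank ?subsetUl.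
Qed.

Lemma rankU_le M A B : rank M (A :|: B) <= rank M A + rank M B.
Proof. by apply: leq_trans (rank_submod M A B); apply: leq_addr. Qed.

(** By submodularity [O] adds over [A] at least the rank that it adds over the larger [B], and that
    is already [#|O|]. *)
Lemma free_overS M A B O P : A \subset B -> O \subset P ->
  rank M (P :|: B) = #|P| + rank M B -> rank M (O :|: A) = #|O| + rank M A.
Proof.
move=> sAB sOP freeP; apply/eqP; rewrite eqn_leq; apply/andP; split.
  by apply: leq_trans (rankU_le _ _ _) _; rewrite leq_add2r rank_le_card.
have := rank_submod M (O :|: A) B; rewrite -setUA (setUidPr sAB).
have : rank M A <= rank M ((O :|: A) :&: B).
  by rewrite rankS // subsetI subsetUr.
have := rankU_le M (P :\: O) (O :|: B).
have PO : (P :\: O) :|: O = P.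
  by rewrite -[RHS](setID P O) (setIidPr sOP) setUC.
rewrite setUA PO freeP; have := rank_le_card M (P :\: O).
by have := cardsID O P; rewrite (setIidPr sOP); lia.
Qed.

Lemma free_over_disjoint M A O :
  rank M (O :|: A) = #|O| + rank M A -> [disjoint O & A].
Proof.
move=> freeO; apply/pred0P=> e /=; apply/negP=> /andP[eO eA].
have [sA sO] : [set e] \subset A /\ [set e] \subset O by rewrite !sub1set.
(* A common element would make [[set e]] free over itself. *)
by have := free_overS sA sO freeO; rewrite setUid cards1; lia.
Qed.

(** Freeness over [A] costs [S] at most [rank M1 A] elements, freeness over [B] at most [rank M2 B];
    intersecting the two remainders adds up the losses. *)
Lemma exists_common_free_over M1 M2 A B S :
    S \in indep M1 -> S \in indep M2 -> exists O : {set T},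
  [/\ O \subset S, rank M1 (O :|: A) = #|O| + rank M1 A,
      rank M2 (O :|: B) = #|O| + rank M2 B
    & #|S| <= #|O| + (rank M1 A + rank M2 B)].
Proof.
move=> i1 i2; have [O1 [sO1 free1 card1]] := exists_free_over A i1.
have [O2 [sO2 free2 card2]] := exists_free_over B i2.
exists (O1 :&: O2); split.
- by rewrite subIset // sO1.
- exact: free_overS (subxx A) (subsetIl O1 O2) free1.
- exact: free_overS (subxx B) (subsetIr O1 O2) free2.
- have : #|O1 :|: O2| <= #|S| by rewrite subset_leq_card // subUset sO1.
  by have := cardsUI O1 O2; lia.
Qed.

End Rank.

(** * The density-based decomposition of [V] in one matroid *)

Section Decomposition.
Variables (R : realType) (T : finType) (M : matroid T) (V : {set T}).
Hypotheses (loopless_M : loopless M) (V_ground : V \subset ground M).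
Implicit Types (A B O X : {set T}) (i j : nat).
Local Notation W := (decomp_union R M V).
Local Notation minor j := (contract (restrict M V) (W j)).
Local Notation part j := (densest_subset R (minor j)).
#[local] Opaque densest_subset.

(** Since x / 0 = 0, an empty part gets density 0, as in [density]; the value [+oo] is ruled out by
    [decomp_union_rises]. *)
Definition part_density j : R := #|part j|%:R / (rank (minor j) (part j))%:R.

Lemma part_density_ge0 j : 0 <= part_density j.
Proof. by rewrite divr_ge0. Qed.

Lemma part_sub j : part j \subset V :\: W j.
Proof.
have /and3P[sU _ _] := densest_subsetP R (minor j).
by apply: subset_trans sU _; rewrite setSD //= subsetIr.
Qed.

Lemma decomp_union_sub j : W j \subset V.
Proof.
elim: j => [|j IHj] /=; first exact: sub0set.
by rewrite subUset IHj (subset_trans (part_sub j)) ?subsetDl.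
Qed.

Lemma decomp_unionS i j : (i <= j)%N -> W i \subset W j.
Proof.
move=> /subnK <-; elim: (j - i)%N => //= n IHn.
exact: subset_trans IHn (subsetUl _ _).
Qed.

Lemma rank_minor j X : X \subset V :\: W j ->
  (rank (minor j) X)%:R = (rank M (X :|: W j))%:R - (rank M (W j))%:R :> R.
Proof.
move=> sX; rewrite -(rank_contract_restrict M (decomp_union_sub j) sX).
by rewrite natrD addrK.
Qed.

(** The minor at level [j] has no loops. This stays a hypothesis until the induction in
    [decomp_union_rises], whose step uses density bounds at the previous level. *)
Let rises j := forall e, e \in V :\: W j -> (rank M (W j) < rank M (e |: W j))%N.

Lemma rank_minor_gt0 j X : rises j -> X \subset V :\: W j -> X != set0 ->
  (0 < rank (minor j) X)%N.
Proof.
move=> Wj sX /set0Pn[e eX].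
have := rank_contract_restrict M (decomp_union_sub j) sX.
have : (rank M (e |: W j) <= rank M (X :|: W j))%N.
  by rewrite rankS // setSU // sub1set.
by have := Wj e (subsetP sX e eX); lia.
Qed.

Lemma density_minor j X : rises j -> X \subset V :\: W j ->
  density R (minor j) X = (#|X|%:R / (rank (minor j) X)%:R)%:E.
Proof.
move=> Wj sX; rewrite /density; case: eqVneq => [->|X0].
  by rewrite cards0 mul0r.
by rewrite gtn_eqF ?rank_minor_gt0.
Qed.

Lemma card_le_part_density_rises j X : rises j -> X \subset V :\: W j ->
  #|X|%:R <= part_density j * (rank (minor j) X)%:R.
Proof.
move=> Wj sX; have [->|X0] := eqVneq X set0.
  by rewrite cards0 mulr_ge0 ?part_density_ge0.
rewrite -ler_pdivrMr ?ltr0n ?rank_minor_gt0 // -lee_fin -density_minor //.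
have /and3P[_ /forallP/(_ X)/implyP + _] := densest_subsetP R (minor j).
rewrite (density_minor Wj (part_sub j)); apply.
by move: sX; rewrite /= (setIidPr V_ground).
Qed.

Lemma card_part_rises j : rises j ->
  #|part j|%:R = part_density j * (rank (minor j) (part j))%:R.
Proof.
move=> Wj; have [U0|U0] := eqVneq (part j) set0.
  by rewrite /part_density U0 cards0 !mul0r.
by rewrite divfK // pnatr_eq0 -lt0n rank_minor_gt0 ?part_sub.
Qed.

(** An element left over that does not raise the rank could join [part j] at no cost in rank,
    exceeding the maximum density. *)
Lemma decomp_union_rises j : rises j.
Proof.
elim: j => [|j IHj] e.
  rewrite /= setD0 setU0 rank0 => eV.
  rewrite (rank_indep _) ?cards1 //.
  by have /forall_inP/(_ e (subsetP V_ground e eV)) := loopless_M.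
rewrite inE => /andP[eW eV]; rewrite ltn_neqAle rankS ?subsetUr // andbT.
apply/negP=> /eqP eqr.
have sX : e |: part j \subset V :\: W j.
  rewrite subUset part_sub sub1set inE eV !andbT.
  by apply: contraNN eW => eW; apply: subsetP (decomp_unionS (leqnSn j)) e eW.
have := card_le_part_density_rises IHj sX.
rewrite rank_minor // -setUA [part j :|: _]setUC -/(W j.+1) -eqr.
rewrite [W j.+1]setUC -rank_minor ?part_sub // -card_part_rises //.
have eP : e \notin part j by apply: contra eW => eP; rewrite /= inE eP orbT.
by rewrite cardsU1 eP ler_nat ltnn.
Qed.

Lemma card_le_part_density j X : X \subset V :\: W j ->
  #|X|%:R <= part_density j * ((rank M (X :|: W j))%:R - (rank M (W j))%:R).
Proof.
move=> sX; rewrite -rank_minor //.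
exact: card_le_part_density_rises (@decomp_union_rises j) sX.
Qed.

Lemma card_part j :
  #|part j|%:R = part_density j * ((rank M (W j.+1))%:R - (rank M (W j))%:R).
Proof.
rewrite card_part_rises ?rank_minor ?part_sub ?[W j.+1]setUC //.
exact: decomp_union_rises.
Qed.

(** Otherwise [part j :|: part j.+1] would be denser than [part j] in the minor at level [j]. *)
Lemma part_density_anti j : part_density j.+1 <= part_density j.
Proof.
have aux (a b c d p q : R) :
  p = d * (b - c) -> p + q <= d * (a - c) -> q <= d * (a - b) by lra.
rewrite {1}/part_density rank_minor ?part_sub // setUC -/(W j.+2).
set r := _ - _.
have r_ge0 : 0 <= r by rewrite subr_ge0 ler_nat rankS ?decomp_unionS.
have [->|r_neq0] := eqVneq r 0; first by rewrite invr0 mulr0 part_density_ge0.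
rewrite ler_pdivrMr ?lt_def ?r_neq0 //.
have dis : [disjoint part j & part j.+1].
  have /subsetDP[_ dis] := part_sub j.+1.
  by rewrite disjoint_sym (disjointWr (subsetUr (W j) (part j)) dis).
have sX : part j :|: part j.+1 \subset V :\: W j.
  apply/subUsetP; split; first exact: part_sub.
  apply: subset_trans (part_sub j.+1) _.
  by apply: setDS; apply: decomp_unionS.
have := card_le_part_density sX; rewrite [_ :|: W j]setUC setUA -/(W j.+2).
have -> : #|part j :|: part j.+1| = (#|part j| + #|part j.+1|)%N.
  by apply/eqP; rewrite (leq_card_setU _ _).2.
rewrite natrD => le; rewrite /r.
exact: aux (card_part j) le.
Qed.

Lemma decomp_union_rank : W (rank M (ground M)) = V.
Proof.
(* Until [V] is exhausted every level raises the rank: a stalled rank forces an empty part, hence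
   maximum density 0, hence no element left. *)
have rank_ge j : W j = V \/ (j <= rank M (W j))%N.
  elim: j => [|j IHj]; first by right.
  have [eqV|neV] := eqVneq (W j) V.
    left; apply/eqP; rewrite eqEsubset decomp_union_sub /=.
    by apply: subset_trans (decomp_unionS (leqnSn j)); rewrite eqV.
  case: IHj => [eqV|le]; first by rewrite eqV eqxx in neV.
  right; apply: leq_ltn_trans le _.
  rewrite ltn_neqAle rankS ?decomp_unionS // andbT; apply/negP=> /eqP eqr.
  have := card_part j; rewrite -eqr subrr mulr0 => /eqP; rewrite pnatr_eq0 => c0.
  have D0 : part_density j = 0 by rewrite /part_density (eqP c0) mul0r.
  have := card_le_part_density (subxx (V :\: W j)); rewrite D0 mul0r.
  rewrite lern0 cards_eq0 setD_eq0 => sVW.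
  by move/eqP: neV; apply; apply/eqP; rewrite eqEsubset decomp_union_sub.
have [//|le] := rank_ge (rank M (ground M)).
apply/eqP; rewrite eqEsubset decomp_union_sub; apply/subsetP=> e eV.
apply: contraLR le => eW; rewrite -ltnNge.
have /(@decomp_union_rises _ e) /leq_trans : e \in V :\: W (rank M (ground M)).
  by rewrite inE eW.
apply; apply: rankS; rewrite subUset sub1set (subsetP V_ground) //=.
exact: subset_trans (decomp_union_sub _) V_ground.
Qed.

Lemma span_decomp_union j : span M (W j) :&: V = W j.
Proof.
apply/setP=> e; rewrite inE; apply/andP/idP => [[/spanP[_ re] eV]|eW].
  apply: contraPT re => eW; have := @decomp_union_rises j e.
  by rewrite inE eW eV => /(_ isT) lt /eqP; rewrite gtn_eqF.
have eV := subsetP (decomp_union_sub j) e eW; split=> //.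
apply/spanP; split; first exact: subsetP V_ground e eV.
by rewrite (setUidPr _) // sub1set.
Qed.

(** [fine] loses nothing here, by [assoc_densityE]. *)
Definition rho v : R := fine (assoc_density R M V v).

Lemma level_exists v : v \in span M V ->
  exists2 j, v \in span M (W j.+1) & v \notin span M (W j).
Proof.
move=> vV; have ex : exists j, v \in span M (W j).
  by exists (rank M (ground M)); rewrite decomp_union_rank.
have [[|j] vj minj] := ex_minnP ex; last first.
  by exists j => //; apply/negP=> /minj; rewrite ltnn.
have /spanP[vM] := vj; rewrite /= setU0 rank0 rank_indep ?cards1 //.
by have /forall_inP/(_ v vM) := loopless_M.
Qed.

Lemma assoc_density_level j v : v \in span M (W j.+1) -> v \notin span M (W j) ->
  assoc_density R M V v = (part_density j)%:E.
Proof.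
move=> vS vN; have vV := subsetP (spanS M (decomp_union_sub j.+1)) v vS.
have lt_jk : (j < rank M (ground M))%N.
  rewrite ltnNge; apply: contraNN vN => /decomp_unionS.
  by rewrite decomp_union_rank => /(spanS M) /subsetP; apply.
rewrite /assoc_density vV /decomp_index.
set a := fun i => _; set s := iota _ _; set i := find a s.
(* The search list starts at 1, so position [n] stands for the union of the first [n.+1] parts. *)
have nth_s n : (n < rank M (ground M))%N -> nth 0%N s n = n.+1.
  by move=> lt; rewrite nth_iota.
have le_ij : (i <= j)%N.
  rewrite leqNgt; apply/negP=> /(before_find 0%N); rewrite nth_s //.
  by rewrite /a vS.
have ai : a i.+1.
  rewrite -[i.+1]nth_s ?(leq_ltn_trans le_ij) // nth_find // has_find size_iota.
  exact: leq_ltn_trans le_ij lt_jk.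
have -> : i = j.
  apply/eqP; rewrite eqn_leq le_ij leqNgt; apply/negP=> lt_ij.
  by rewrite (subsetP (spanS M (decomp_unionS lt_ij)) v ai) in vN.
rewrite /decomp_part /= density_minor ?part_sub //.
exact: decomp_union_rises.
Qed.

Lemma rho_level j v : v \in span M (W j.+1) -> v \notin span M (W j) ->
  rho v = part_density j.
Proof. by move=> vS vN; rewrite /rho (assoc_density_level vS vN). Qed.

Lemma rho_notin_span v : v \notin span M V -> rho v = 0.
Proof. by rewrite /rho /assoc_density => /negPf ->. Qed.

Lemma assoc_densityE v : assoc_density R M V v = (rho v)%:E.
Proof.
have [vV|vV] := boolP (v \in span M V).
  by have [j vS vN] := level_exists vV; rewrite /rho (assoc_density_level vS vN).
by rewrite rho_notin_span // /assoc_density (negPf vV).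
Qed.

Lemma rho_part j e : e \in part j -> rho e = part_density j.
Proof.
move=> eU; have /setDP[eV eW] := subsetP (part_sub j) e eU.
apply: rho_level; last first.
  by apply: contraNN eW => eS; rewrite -span_decomp_union inE eS.
have /setIP[] // : e \in span M (W j.+1) :&: V.
by rewrite span_decomp_union /= inE eU orbT.
Qed.

Lemma rho_gt0 e : e \in V -> 0 < rho e.
Proof.
move=> eV; have eS : e \in span M V.
  apply/spanP; split; first exact: subsetP V_ground e eV.
  by rewrite (setUidPr _) // sub1set.
have [j vS vN] := level_exists eS.
have eU : e \in part j.
  have : e \in W j.+1 by rewrite -span_decomp_union inE vS.
  rewrite /= inE => /orP[|//]; rewrite -span_decomp_union inE => /andP[+ _].
  by rewrite (negPf vN).
rewrite (rho_part eU) lt_def part_density_ge0 andbT; apply/eqP=> D0.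
have /eqP := card_part j; rewrite D0 mul0r pnatr_eq0 cards_eq0 => /eqP U0.
by rewrite U0 inE in eU.
Qed.

Lemma sum_rho_part (F : R -> R) j X :
  \sum_(e in X :&: W j.+1) F (rho e) =
  \sum_(e in X :&: W j) F (rho e) + #|X :&: part j|%:R * F (part_density j).
Proof.
rewrite (big_setID (W j)) /= -setIA setIUl setIid.
have /subsetDP[_ dis] := part_sub j.
have -> : part j :&: W j = set0 by apply/eqP; rewrite setI_eq0.
rewrite setU0; congr (_ + _).
have -> : (X :&: (W j :|: part j)) :\: W j = X :&: part j.
  by rewrite -setIDA setDUl setDv set0U (setDidPl _) // disjoint_sym.
rewrite (eq_bigr (fun=> F (part_density j))); last first.
  by move=> e; rewrite inE => /andP[_ /rho_part ->].
by rewrite sumr_const mulr_natl.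
Qed.

(** The layers are differences of spans, so that elements outside [V] are counted too, as needed for
    a free set avoiding [V]. *)
Lemma sum_rho_span (F : R -> R) j X :
  \sum_(e in X :&: span M (W j.+1)) F (rho e) =
  \sum_(e in X :&: span M (W j)) F (rho e) +
  (#|X :&: span M (W j.+1)|%:R - #|X :&: span M (W j)|%:R) * F (part_density j).
Proof.
have sS := spanS M (decomp_unionS (leqnSn j)).
rewrite (big_setID (span M (W j))) -(cardsID (span M (W j)) (X :&: span M (W j.+1))).
rewrite -setIA (setIidPr sS) natrD addrAC subrr add0r; congr (_ + _).
rewrite (eq_bigr (fun=> F (part_density j))); last first.
  by move=> e /setDP[/setIP[_ eS] eN]; rewrite (rho_level eS eN).
by rewrite sumr_const mulr_natl.
Qed.

(** By submodularity [X :&: part j] adds no more rank over [W j] than over [X :&: W j]. *)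
Lemma card_capI_part j X : #|X :&: part j|%:R <=
  part_density j * ((rank M (X :&: W j.+1))%:R - (rank M (X :&: W j))%:R).
Proof.
have sX : X :&: part j \subset V :\: W j.
  by apply: subset_trans (part_sub j); apply: subsetIr.
apply: le_trans (card_le_part_density sX) _.
apply: ler_wpM2l; first exact: part_density_ge0.
rewrite lerBlDr addrAC lerBrDr -!natrD ler_nat.
have := rank_submod M (X :&: W j.+1) (W j).
rewrite -setIA (setIidPr (decomp_unionS (leqnSn j))) setIUr.
by rewrite setUAC (setUidPr (subsetIr X (W j))) setUC.
Qed.

(** Each part contributes at most the rank increment given by [card_capI_part], and the increments
    telescope. *)
Lemma sum_inv_rho B : B \subset V -> \sum_(e in B) (rho e)^-1 <= (rank M B)%:R.
Proof.
suff le j : \sum_(e in B :&: W j) (rho e)^-1 <= (rank M (B :&: W j))%:R.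
  by move=> sB; have := le (rank M (ground M)); rewrite decomp_union_rank (setIidPl sB).
elim: j => [|j IHj]; first by rewrite setI0 big_set0.
rewrite (sum_rho_part GRing.inv) -lerBrDl.
apply: le_trans (lerB (lexx _) IHj).
have [->|D0] := eqVneq (part_density j) 0.
  by rewrite invr0 mulr0 subr_ge0 ler_nat rankS // setIS // decomp_unionS.
rewrite ler_pdivrMr ?lt_def ?D0 ?part_density_ge0 // mulrC.
exact: card_capI_part.
Qed.

(* Abel summation along the decomposition: the parts' densities decrease, and
   the first [j] parts leave outside [A] at least as much rank as [O] uses. *)
Lemma sum_free_over_le A O (g : R -> R) :
    {homo g : x y / x <= y} -> (forall x, 0 <= g x) -> g 0 = 0 ->
    rank M (O :|: A) = (#|O| + rank M A)%N ->
  \sum_(v in O) g (rho v) <= \sum_(e in V :\: A) g (rho e) / rho e.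
Proof.
(* One level of the summation: the new rank beyond the share of [A] is at most [c / D], with [c]
   elements of the part outside [A], each paying [G / D]. The remaining slack is then revalued from
   [G] down to [G']. *)
have aux (D G G' r' r a' a n' n S Y c p : R) : 0 < D -> 0 <= G ->
    0 <= r' - a' - n' -> G' <= G -> D * (r' - r) = p + c -> p <= D * (a' - a) ->
    S + (r - a - n) * G <= Y ->
  S + (n' - n) * G + (r' - a' - n') * G' <= Y + c * (G / D).
  move=> D0 G0 s0 leG eqp lep leY.
  have le1 := ler_wpM2l s0 leG.
  have leD : (r' - r) - (a' - a) <= c / D.
    by rewrite ler_pdivlMr // mulrC mulrBr eqp; lra.
  have := ler_wpM2r G0 leD; rewrite mulrAC -mulrA => le2.
  by lra.
move=> g_homo g_ge0 g0 freeO.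
(* The rank of [W j] taken neither by [A] nor by [O]; it is nonnegative because [O] is free over
   [A]. *)
pose slack j : R :=
  (rank M (W j))%:R - (rank M (A :&: W j))%:R - #|O :&: span M (W j)|%:R.
have slack_ge0 j : 0 <= slack j.
  rewrite subr_ge0 lerBrDr -natrD ler_nat.
  rewrite -(free_overS (subsetIl A (W j)) (subsetIl O (span M (W j))) freeO).
  rewrite -(@rankU_span _ M (W j) (span M (W j)) (subxx _)) rankS //.
  by rewrite setUSS // subsetIr.
have sO j : \sum_(v in O :&: span M (W j)) g (rho v) + slack j * g (part_density j)
    <= \sum_(e in ~: A :&: W j) g (rho e) / rho e.
  elim: j => [|j IHj].
    have O0 : O :&: span M (W 0) = set0.
      apply/eqP; rewrite -subset0; apply/subsetP=> v /setIP[_ /spanP[vM]].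
      rewrite /= setU0 rank0 rank_indep ?cards1 //.
      by have /forall_inP/(_ v vM) := loopless_M.
    by rewrite /slack O0 cards0 !setI0 !big_set0 rank0 !subr0 mul0r addr0.
  rewrite (sum_rho_part (fun x => g x / x)) sum_rho_span.
  have [D0|D_neq0] := eqVneq (part_density j) 0.
    have := part_density_anti j; rewrite D0 g0 invr0 !mulr0 !addr0 => D1.
    have -> : part_density j.+1 = 0.
      by apply/eqP; rewrite eq_le D1 part_density_ge0.
    by move: IHj; rewrite D0 g0 !mulr0 !addr0.
  have D_gt0 : 0 < part_density j by rewrite lt_def D_neq0 part_density_ge0.
  have := card_capI_part j A.
  have : #|part j|%:R = #|A :&: part j|%:R + #|~: A :&: part j|%:R :> R.
    by rewrite -natrD -(cardsID A) setIC setDE [~: A :&: _]setIC.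
  rewrite card_part => eqc lec.
  apply: aux D_gt0 (g_ge0 _) (slack_ge0 j.+1) (g_homo _ _ (part_density_anti j)) eqc lec IHj.
have := sO (rank M (ground M)).
rewrite decomp_union_rank [~: A :&: V]setIC -setDE; apply: le_trans.
rewrite (big_setID (span M V)) /= -[X in _ <= _ + X]addr0.
have -> : \sum_(v in O :\: span M V) g (rho v) = 0.
  by rewrite big1 // => v /setDP[_ vN]; rewrite rho_notin_span.
rewrite lerD2l; have := slack_ge0 (rank M (ground M)); rewrite /slack decomp_union_rank.
by move=> ge0; rewrite addr0 mulr_ge0.
Qed.

End Decomposition.

(** * Weights trading one matroid against the other, and the final estimate *)

Lemma weight_bound (R : realType) (b s t x y : R) : 0 < x -> 0 < y ->
  x + y <= b -> s + t = b -> Num.max 0 (b * x - s ^+ 2) / x <= t ^+ 2 / y.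
Proof.
move=> x0 y0 lexy stb; rewrite ler_pdivrMr // ge_max; apply/andP; split.
  by apply: mulr_ge0 (ltW x0); apply: divr_ge0 (sqr_ge0 t) (ltW y0).
rewrite mulrAC ler_pdivlMr //.
(* With denominators cleared, the two sides differ by exactly the nonnegative terms of [hs] and
   [hb]. *)
have hs : 0 <= x * (y - t) ^+ 2 + y * (x - s) ^+ 2.
  by apply: addr_ge0; apply: mulr_ge0 (sqr_ge0 _); apply: ltW.
have hb : 0 <= (b - (x + y)) * (x * y).
  by apply: mulr_ge0; [rewrite subr_ge0|apply: mulr_ge0; apply: ltW].
rewrite -subr_ge0; apply: le_trans (addr_ge0 hs hb) _.
by rewrite le_eqVlt; apply/orP; left; apply/eqP; rewrite -stb; ring.
Qed.

Lemma sum_weight_le (R : realType) (T : finType) (M N : matroid T)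
    (V A O : {set T}) (b s t : R) :
    loopless M -> loopless N -> V \subset ground M -> V \subset ground N ->
    A \subset V -> rank M (O :|: A) = (#|O| + rank M A)%N -> 0 <= b -> s + t = b ->
    (forall e, e \in V -> rho R M V e + rho R N V e <= b) ->
  \sum_(v in O) (b * rho R M V v - s ^+ 2) <= t ^+ 2 * (rank N (V :\: A))%:R.
Proof.
move=> llM llN VM VN sAV freeO b0 stb rho_le.
pose g x := Num.max 0 (b * x - s ^+ 2).
have g_homo : {homo g : x y / x <= y}.
  by move=> x y le; rewrite /g ge_max !le_max lexx lerB ?orbT // ler_wpM2l.
have g_ge0 x : 0 <= g x by rewrite le_max lexx.
have g0 : g 0 = 0.
  by rewrite /g; apply/max_idPl; rewrite mulr0 sub0r oppr_le0 sqr_ge0.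
apply: le_trans (_ : \sum_(v in O) g (rho R M V v) <= _).
  by apply: ler_sum => v _; rewrite le_max lexx orbT.
apply: le_trans (sum_free_over_le llM VM g_homo g_ge0 g0 freeO) _.
apply: le_trans (_ : \sum_(e in V :\: A) t ^+ 2 * (rho R N V e)^-1 <= _).
  apply: ler_sum => e /setDP[eV _].
  by apply: weight_bound (rho_le e eV) stb; apply: rho_gt0.
rewrite -mulr_sumr ler_wpM2l ?sqr_ge0 //.
by apply: sum_inv_rho => //; apply: subsetDl.
Qed.

Lemma ge_sum_weight (R : realDomainType) (T : finType) (O : {set T}) (f g : T -> R)
    (b c s : R) : 0 <= b -> (forall v, v \in O -> c <= f v + g v) ->
  #|O|%:R * (b * c - 2 * s ^+ 2) <=
    \sum_(v in O) (b * f v - s ^+ 2) + \sum_(v in O) (b * g v - s ^+ 2).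
Proof.
move=> b0 le_c; rewrite -big_split /= mulr_natl -sumr_const; apply: ler_sum => v vO.
by have := ler_wpM2l b0 (le_c v vO); lra.
Qed.

(** With s = c / 2 both sides share the positive factor [b - c / 2]; cancelling it leaves
    [n * c <= (b - c / 2) * m], and [b <= c * (1 + eps)] then bounds [n] by [(1 / 2 + eps) * m]. *)
Lemma dcs_ratio (R : realFieldType) (b c eps m n mu : R) :
    0 < eps -> 0 <= m -> c + 7 <= b -> b <= (c - 4) * (1 + eps) -> mu <= n + m ->
    n * (b * c - 2 * (c / 2) ^+ 2) <= (b - c / 2) ^+ 2 * m ->
  mu <= (3 / 2 + eps) * m.
Proof.
move=> eps0 m0 hb7 hb lemu.
(* The two bounds on [b] combine to [11 <= (c - 4) * eps]. *)
have c_gt4 : 4 < c by clear -hb7 hb eps0; nra.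
have -> : n * (b * c - 2 * (c / 2) ^+ 2) = (b - c / 2) * (n * c) by field.
rewrite expr2 -mulrA ler_pM2l; last by clear -hb7 c_gt4; lra.
move=> le_nc.
have le_b : b <= c * (1 + eps) by clear -hb eps0; nra.
have le_bm : (b - c / 2) * m <= (1 / 2 + eps) * m * c.
  rewrite mulrAC; apply: ler_wpM2r => //; clear -le_b; lra.
have : n <= (1 / 2 + eps) * m.
  have c_gt0 : 0 < c by clear -c_gt4; lra.
  by rewrite -(ler_pM2r c_gt0); apply: le_trans le_bm.
by clear -lemu; lra.
Qed.

Theorem theorem4 (R : realType) (T : finType) (V : {set T})
    (M1 M2 : matroid T) (k : nat) (eps : R) (beta beta_minus : int)
    (V' : {set T})
    (ground1 : ground M1 = V) (ground2 : ground M2 = V)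
    (rank1 : rank M1 V = k) (rank2 : rank M2 V = k)
    (loopless1 : loopless M1) (loopless2 : loopless M2)
    (eps_gt0 : 0 < eps)
    (beta_ge : beta_minus + 7 <= beta)
    (beta_le : beta%:~R <= (beta_minus - 4)%:~R * (1 + eps))
    (dcs : is_DCS R M1 M2 beta beta_minus V') :
  (common_indep_max M1 M2 V)%:R <=
    (3 / 2 + eps) * (common_indep_max M1 M2 V')%:R.
Proof.
have [sV1 dense_in dense_out] := dcs.
have sV2 : V' \subset ground M2 by rewrite ground2 -ground1.
pose b : R := beta%:~R; pose b' : R := beta_minus%:~R.
have rho_in e : e \in V' -> rho R M1 V' e + rho R M2 V' e <= b.
  by move=> /dense_in; rewrite !assoc_densityE // -EFinD lee_fin.
have rho_out v : v \in V :\: V' -> b' <= rho R M1 V' v + rho R M2 V' v.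
  by rewrite -ground1 => /dense_out; rewrite !assoc_densityE // -EFinD lee_fin.
have [A sA cover] := matroid_intersection M1 M2 V'.
have [S [sS i1 i2 cS]] := common_indep_max_witness M1 M2 V.
have [O [sO freeO1 freeO2 cardO]] := exists_common_free_over A (V' :\: A) i1 i2.
have {}cardO : (common_indep_max M1 M2 V <= #|O| + common_indep_max M1 M2 V')%N.
  by rewrite -cS (leq_trans cardO) // leq_add2l.
(* Freeness in [M1] keeps [O] off [A], freeness in [M2] keeps it off [V' :\: A]. *)
have O_out v : v \in O -> v \in V :\: V'.
  move=> vO; rewrite inE (subsetP sS) ?(subsetP sO) // andbT.
  have := free_over_disjoint freeO2 => /disjointFr /(_ vO).
  by rewrite inE (disjointFr (free_over_disjoint freeO1) vO) /= => ->.
have b_ge7 : b' + 7 <= b by rewrite /b /b' -[7]/(7%:~R) -intrD ler_int.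
have b_le : b <= (b' - 4) * (1 + eps) by move: beta_le; rewrite intrD.
have b_ge0 : 0 <= b by clear -b_ge7 b_le eps_gt0; nra.
have st : b' / 2 + (b - b' / 2) = b by rewrite addrC subrK.
have le1 := sum_weight_le loopless1 loopless2 sV1 sV2 sA freeO1 b_ge0 st rho_in.
have rho_in' e : e \in V' -> rho R M2 V' e + rho R M1 V' e <= b.
  by rewrite addrC; apply: rho_in.
have := sum_weight_le loopless2 loopless1 sV2 sV1 (subsetDl V' A) freeO2 b_ge0 st rho_in'.
(* The complement of [V' :\: A] in [V'] is [A], so the two bounds involve exactly the ranks summed
   in [cover]. *)
rewrite setDDr setDv set0U (setIidPr sA) => le2.
apply: (@dcs_ratio R b b' eps _ #|O|%:R) => //; first by rewrite -natrD ler_nat.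
apply: le_trans (@ge_sum_weight _ _ O (rho R M1 V') (rho R M2 V') b b' _ b_ge0 _) _.
  by move=> v vO; apply: rho_out; apply: O_out.
apply: le_trans (lerD le1 le2) _.
rewrite -mulrDr -natrD addnC; apply: ler_wpM2l; first exact: sqr_ge0.
by rewrite ler_nat.
Qed.
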